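(* Let $d\ge2$ and let $(k_0,\ldots,k_d)$ be a unit partition. \begin{enumerate} \item $$\mathrm{lcm}(k_0,\ldots,k_d)^2\le k_0\cdots k_d\le t_d^2,$$ with equality in the second inequality only for the Sylvester partition (up to reordering). \item $$(d+1)^{d+1}\le k_0\cdots k_d,$$ with equality if and only if $(k_0,\ldots,k_d)=(d+1,\ldots,d+1)$. \item Let $d\ge3$ and $k_0\le\ldots\le k_d$. Then $$\frac{k_0\cdots k_d}{\mathrm{lcm}(k_0,\ldots,k_d)}\le k_0\cdots k_{d-1}\le 2t_{d-1}^2,$$ with equality in the second inequality if and only if $(k_0,\ldots,k_d)$ is the enlarged Sylvester partition or $(2,6,6,6)$. \end{enumerate}
   Context: A unit partition is a family of positive integers $(k_0,\ldots,k_d)$ with $\sum_{i=0}^d 1/k_i=1$. Sylvester sequence: $y_0=2$, $y_n=1+y_0\cdots y_{n-1}$ for $n\ge1$; and $t_n=y_n-1$ for $n\ge 0$. The Sylvester partition of length $d$ is $(y_0,\ldots,y_{d-1},t_d)$. The enlarged Sylvester partition of length $d$ is $(y_0,\ldots,y_{d-2},2t_{d-1},2t_{d-1})$. *)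

(* Defs.v *)
From HB Require Import structures.
From mathcomp Require Import all_boot all_order all_algebra.

Set Implicit Arguments.
Unset Strict Implicit.
Unset Printing Implicit Defensive.

Import Order.TTheory GRing.Theory Num.Theory.

Local Open Scope nat_scope.

Definition unit_partition (d : nat) (k : d.+1.-tuple nat) : Prop :=
  (forall i : 'I_d.+1, 0 < tnth k i) /\
  (\sum_(i < d.+1) ((tnth k i)%:R : rat)^-1 = 1)%R.

(* The course-of-values recursion y_n = 1 + y_0 ... y_(n-1) is run on the list
   of previous values [y_0; ...; y_(n-1)]; the base value y_0 = 2 comes from the
   empty product.  See sylvester_y0, sylvester_yS and sylvester_prefixE. *)
Fixpoint sylvester_prefix (n : nat) : seq nat :=
  if n is m.+1 then
    rcons (sylvester_prefix m) (1 + \prod_(y <- sylvester_prefix m) y)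
  else [::].

Definition sylvester_y (n : nat) : nat := 1 + \prod_(y <- sylvester_prefix n) y.

Definition sylvester_t (n : nat) : nat := (sylvester_y n).-1.

Lemma sylvester_prefixE (n : nat) : sylvester_prefix n = mkseq sylvester_y n.
Proof. by elim: n => [|n IHn] //=; rewrite mkseqS -IHn. Qed.

Lemma sylvester_y0 : sylvester_y 0 = 2.
Proof. by rewrite /sylvester_y big_nil. Qed.

Lemma sylvester_yS (n : nat) :
  sylvester_y n = 1 + \prod_(i < n) sylvester_y i.
Proof.
by rewrite {1}/sylvester_y sylvester_prefixE big_map -(big_mkord xpredT)
  /index_iota subn0.
Qed.

Definition sylvester_partition (d : nat) : seq nat :=
  rcons (mkseq sylvester_y d) (sylvester_t d).

Definition enlarged_sylvester_partition (d : nat) : seq nat :=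
  mkseq sylvester_y d.-1 ++ [:: 2 * sylvester_t d.-1; 2 * sylvester_t d.-1].

Definition prod_entries (d : nat) (k : d.+1.-tuple nat) : nat :=
  \prod_(i < d.+1) tnth k i.

Definition prod_but_last (d : nat) (k : d.+1.-tuple nat) : nat :=
  \prod_(i < d) tnth k (widen_ord (leqnSn d) i).

Definition lcm_entries (d : nat) (k : d.+1.-tuple nat) : nat :=
  \big[lcmn/1]_(i < d.+1) tnth k i.

(* Main.v *)
Require Import Defs.
From HB Require Import structures.
From mathcomp Require Import all_boot all_order all_algebra.
From mathcomp Require Import ring lra zify.

Set Implicit Arguments.
Unset Strict Implicit.
Unset Printing Implicit Defensive.

Import Order.TTheory GRing.Theory Num.Theory.

Local Open Scope nat_scope.

(* Sort the partition and put x_i = 1/k_i.  Since 1 - (x_0 + ... + x_(m-1)) is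
   a positive fraction with denominator k_0 ... k_(m-1), it is at least
   x_0 ... x_(m-1), with equality for the Sylvester sequence; an AM-GM and Abel
   summation argument (majorization) then shows that the partial sums of x never
   exceed those of 1/y_i.  Hence, with K = k_d and r = d - j, x is majorized by
   (1/y_0, ..., 1/y_(j-1), 1/t_j - r/K, 1/K, ..., 1/K) for every j, so that
     k_0 ... k_(d-1) (K - r t_j) <= t_j^2 K^r.
   The case j = d bounds the full product.  The product without k_d is bounded by
   j = d - 1 when K >= 2 t_(d-1), and otherwise by the j with
   (r+1) t_j <= K < r t_(j+1): the bound is checked at the two end points and
   extended by convexity.
   For the lcm, an entry of maximal p-adic valuation divides the lcm of the other
   entries, so the maximal valuation occurs twice. *)

(** * The Sylvester sequence and its products *)

Lemma sylvester_tE n : sylvester_t n = \prod_(i < n) sylvester_y i.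
Proof. by rewrite /sylvester_t sylvester_yS. Qed.

Lemma sylvester_y_t n : sylvester_y n = (sylvester_t n).+1.
Proof. by rewrite sylvester_tE sylvester_yS. Qed.

Lemma sylvester_t0 : sylvester_t 0 = 1.
Proof. by rewrite sylvester_tE big_ord0. Qed.

Lemma sylvester_tS n : sylvester_t n.+1 = sylvester_t n * (sylvester_t n).+1.
Proof. by rewrite !sylvester_tE big_ord_recr -sylvester_tE -sylvester_y_t. Qed.

Lemma sylvester_t_gt0 n : 0 < sylvester_t n.
Proof. by elim: n => [|n IHn]; rewrite ?sylvester_t0 // sylvester_tS muln_gt0 IHn. Qed.

Lemma ltn_sylvester_t n : n < sylvester_t n.
Proof.
elim: n => [|n IHn]; first by rewrite sylvester_t0.
by rewrite sylvester_tS; nia.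
Qed.

(** * Majorization: from partial sums to products *)

Section Majorization.
Local Open Scope ring_scope.

Lemma sum_inv_sylvester n :
  \sum_(i < n) (sylvester_y i)%:R^-1 = 1 - (sylvester_t n)%:R^-1 :> rat.
Proof.
elim: n => [|n IHn]; first by rewrite big_ord0 sylvester_t0 invr1 subrr.
rewrite big_ord_recr /= IHn sylvester_y_t sylvester_tS natrM -[in RHS]natr1 -natr1.
have : 0 < (sylvester_t n)%:R :> rat by rewrite ltr0n sylvester_t_gt0.
move: (_%:R) => t t0; field; apply/andP; split; lra.
Qed.

Lemma prod_inv_sylvester n :
  \prod_(i < n) (sylvester_y i)%:R^-1 = (sylvester_t n)%:R^-1 :> rat.
Proof. by rewrite prodfV -natr_prod -sylvester_tE. Qed.

(** Abel summation: as the partial sums of [u] before the last are nonnegative and [w] increases,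
    all weights so far may be raised to the current one. The total then carries a single weight, and
    its sign decides. *)
Lemma sum_mul_le0 (R : realDomainType) n (u w : nat -> R) :
  (forall i, 0 <= w i) -> {homo w : i j / (i <= j)%N >-> i <= j} ->
  (forall m, (m < n)%N -> 0 <= \sum_(i < m) u i) -> \sum_(i < n) u i <= 0 ->
  \sum_(i < n) u i * w i <= 0.
Proof.
move=> w0 wh; case: n => [|n] u0 un; first by rewrite big_ord0.
suff H m : (m <= n)%N ->
    \sum_(i < m.+1) u i * w i <= (\sum_(i < m.+1) u i) * w m.
  by apply: le_trans (H n (leqnn n)) _; rewrite mulr_le0_ge0.
elim: m => [|m IHm] mn; first by rewrite !big_ord1.
rewrite big_ord_recr [X in _ <= X * _]big_ord_recr /= mulrDl lerD2r.
apply: le_trans (IHm (ltnW mn)) _.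
by rewrite ler_wpM2l ?wh // u0.
Qed.

(* AM-GM on the ratios [s i / x i], whose mean is at most 1 by Abel summation. *)
Lemma prod_le_of_partial_sums (R : realFieldType) n (s x : nat -> R) :
  (forall i, 0 <= s i) -> (forall i, 0 < x i) ->
  {homo x : i j / (i <= j)%N >-> j <= i} ->
  (forall m, (m < n)%N -> \sum_(i < m) x i <= \sum_(i < m) s i) ->
  \sum_(i < n) s i <= \sum_(i < n) x i ->
  \prod_(i < n) s i <= \prod_(i < n) x i
    ?= iff [forall i : 'I_n, s i == x i].
Proof.
move=> s0 x0 xh D Dn.
case: n D Dn => [|n] D Dn.
  by rewrite !big_ord0; apply/leif_refl/forallP; case.
pose E (i : 'I_n.+1) := s i / x i.
have sumE : \sum_(i < n.+1) E i <= n.+1%:R.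
  have -> : n.+1%:R = \sum_(i < n.+1) 1 :> R by rewrite sumr_const card_ord.
  rewrite -subr_le0 -sumrB.
  under eq_bigr => i _ do
    rewrite /E -(divff (lt0r_neq0 (x0 i))) -mulrBl.
  apply: (@sum_mul_le0 _ _ (fun i => s i - x i) (fun i => (x i)^-1)).
  - by move=> i; rewrite invr_ge0 ltW.
  - by move=> i j ij; rewrite lef_pV2 ?posrE ?xh.
  - by move=> m mn; rewrite sumrB subr_ge0 D.
  - by rewrite sumrB subr_le0.
have sumE0 : 0 <= \sum_(i < n.+1) E i.
  by apply: sumr_ge0 => i _; rewrite divr_ge0 // ltW.
have X0 : 0 < \prod_(i < n.+1) x i by apply: prodr_gt0.
have [AGMle AGMeq] := leif_AGM (A := 'I_n.+1) (E := E)
  (fun i _ => divr_ge0 (s0 i) (ltW (x0 i))).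
rewrite card_ord in AGMle AGMeq.
set mu := _ / _ in AGMle AGMeq.
have mu0 : 0 <= mu by rewrite divr_ge0.
have mu1 : mu <= 1 by rewrite ler_pdivrMr ?mul1r ?ltr0n.
have mun : mu ^+ n.+1 <= 1 by rewrite exprn_ile1.
have prodE : \prod_(i < n.+1) E i = \prod_(i < n.+1) s i / \prod_(i < n.+1) x i.
  by rewrite prodf_div.
have le1 : \prod_(i < n.+1) E i <= 1 by apply: le_trans mun.
split; first by rewrite -[leRHS]mul1r -ler_pdivrMr // -prodE.
apply/eqP/forallP => [eqsx | eqsx]; last by apply: eq_bigr => i _; apply/eqP.
(* In the equality case all ratios coincide, and a nonnegative number with [n.+1]-th power 1 is
   1. *)
have prod1 : \prod_(i < n.+1) E i = 1 by rewrite prodE eqsx divff ?lt0r_neq0.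
have /forall_inP Ec : [forall i in 'I_n.+1, forall j in 'I_n.+1, E i == E j].
  by rewrite -AGMeq eq_le AGMle prod1.
move=> i; have Ei j : E j = E i.
  by have /forall_inP/(_ i isT)/eqP := Ec j isT.
move/eqP: prod1; under eq_bigr => j _ do rewrite Ei.
rewrite prodr_const card_ord pexpr_eq1 ?divr_ge0 // ?ltW // => /eqP Ei1.
by rewrite -(divfK (lt0r_neq0 (x0 i)) (s i)) -/(E i) Ei1 mul1r.
Qed.

(** * Sorted unit partitions against the Sylvester sequence *)

(** A total function spares bound proofs on indices; a finite sorted list extends to one by
    repeating its last entry. *)
Definition sorted_unit_partition (d : nat) (f : nat -> nat) : Prop :=
  [/\ forall i, (0 < f i)%N, {homo f : i j / (i <= j)%N}
    & \sum_(i < d.+1) (f i)%:R^-1 = 1 :> rat].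

(** Integrality of the numerator is the point: it turns a positive gap below 1 into a gap of at
    least one over the denominator. *)
Lemma sum_inv_common_denom n (f : nat -> nat) : (forall i, 0 < f i)%N ->
  exists N : nat,
    \sum_(i < n) (f i)%:R^-1 = N%:R / \prod_(i < n) (f i)%:R :> rat.
Proof.
move=> f0; elim: n => [|n [N IHn]]; first by exists 0; rewrite !big_ord0 mul0r.
exists (N * f n + \prod_(i < n) f i)%N.
rewrite !big_ord_recr /= {}IHn natrD natrM natr_prod.
have : (f n)%:R != 0 :> rat by rewrite pnatr_eq0 -lt0n.
have : \prod_(i < n) (f i)%:R != 0 :> rat.
  by apply/prodf_neq0 => i _; rewrite pnatr_eq0 -lt0n.
move: (\prod_(i < n) _) (_%:R) (N%:R) => p q M p0 q0.
by field; rewrite p0 q0.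
Qed.

Lemma prod_inv_le_tail d f m : sorted_unit_partition d f -> (m <= d)%N ->
  \prod_(i < m) (f i)%:R^-1 <= 1 - \sum_(i < m) (f i)%:R^-1 :> rat.
Proof.
move=> [f0 fh fS] md.
have : 0 < 1 - \sum_(i < m) (f i)%:R^-1 :> rat.
  rewrite -[X in X - _]fS -(subnKC md) -addnS big_split_ord /=.
  rewrite addrAC subrr add0r.
  rewrite big_ord_recl ltr_pwDl ?invr_gt0 ?ltr0n //.
  by apply: sumr_ge0 => i _; rewrite invr_ge0.
have [N ->] := sum_inv_common_denom m f0.
rewrite prodfV.
have : 0 < (\prod_(i < m) f i)%:R :> rat by rewrite ltr0n prodn_gt0.
rewrite -natr_prod; move: (\prod_(i < m) f i)%N => p p0.
rewrite subr_gt0 ltr_pdivrMr // mul1r ltr_nat => Np.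
rewrite -[X in X - _](divff (lt0r_neq0 p0)) -mulrBl -[leLHS]mul1r ler_wpM2r //.
  by rewrite invr_ge0 ltW.
by rewrite lerBrDr nat1r ler_nat.
Qed.

(* At a first index where this failed, majorization would bound the product of
   the [(f i)^-1] below by [(sylvester_t m)^-1], and the latter exceeds the
   remaining sum. *)
Lemma sum_inv_le_sylvester d f m : sorted_unit_partition d f -> (m <= d)%N ->
  \sum_(i < m) (f i)%:R^-1 <= \sum_(i < m) (sylvester_y i)%:R^-1 :> rat.
Proof.
move=> hf; have [f0 fh _] := hf; elim/ltn_ind: m => m IHm md.
rewrite leNgt; apply/negP => lt_yf.
have y0 i : 0 <= (sylvester_y i)%:R^-1 :> rat by rewrite invr_ge0.
have f0' i : 0 < (f i)%:R^-1 :> rat by rewrite invr_gt0 ltr0n.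
have fh' : {homo (fun i => (f i)%:R^-1 : rat) : i j / (i <= j)%N >-> j <= i}.
  by move=> i j ij; rewrite lef_pV2 ?posrE ?ltr0n // ler_nat fh.
have [le_yf _] := prod_le_of_partial_sums y0 f0' fh'
  (fun l lm => IHm l lm (leq_trans (ltnW lm) md)) (ltW lt_yf).
have := le_trans le_yf (prod_inv_le_tail hf md).
by move: lt_yf; rewrite sum_inv_sylvester prod_inv_sylvester; lra.
Qed.

(* The partition is majorized by
   [1/y_0, ..., 1/y_(j-1), 1/t_j - r/K, 1/K, ..., 1/K] with [K = f (j + r)]. *)
Lemma prod_le_truncated_sylvester j r f : sorted_unit_partition (j + r) f ->
  (r * sylvester_t j < f (j + r))%N ->
  ((\prod_(i < j + r) f i) * (f (j + r) - r * sylvester_t j) <=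
     sylvester_t j ^ 2 * f (j + r) ^ r)%N /\
  ((\prod_(i < j + r) f i) * (f (j + r) - r * sylvester_t j) =
     sylvester_t j ^ 2 * f (j + r) ^ r ->
   [/\ forall i, (i < j)%N -> f i = sylvester_y i,
       ((f j)%:R^-1 = (sylvester_t j)%:R^-1 - r%:R / (f (j + r)%N)%:R :> rat)%R
     & forall i, (j < i <= j + r)%N -> f i = f (j + r)])%N.
Proof.
move=> hf ltK; have [f0 fh fS] := hf.
set K := f (j + r) in ltK *; set t := sylvester_t j in ltK *.
have K0 : 0 < K%:R :> rat by rewrite ltr0n; apply: f0.
have t0 : 0 < t%:R :> rat by rewrite ltr0n sylvester_t_gt0.
pose x i : rat := (f i)%:R^-1.
pose s i : rat := if (i < j)%N then (sylvester_y i)%:R^-1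
  else if i == j then t%:R^-1 - r%:R / K%:R else K%:R^-1.
have sj : s j = t%:R^-1 - r%:R / K%:R by rewrite /s ltnn eqxx.
have s_lt i : (i < j)%N -> s i = (sylvester_y i)%:R^-1 by rewrite /s => ->.
have s_gt i : (j < i)%N -> s i = K%:R^-1.
  by move=> ji; rewrite /s ltnNge ltnW //= gtn_eqF.
have sjE : s j = (K - r * t)%N%:R / (t%:R * K%:R).
  rewrite sj natrB 1?ltnW // natrM; field.
  by rewrite !lt0r_neq0.
have s0 i : 0 <= s i.
  rewrite /s; case: ifP => _; first by rewrite invr_ge0.
  by case: ifP => _; rewrite ?invr_ge0 // -sj sjE divr_ge0 // mulr_ge0 ?ltW.
have x0 i : 0 < x i by rewrite invr_gt0 ltr0n.
have xh : {homo x : i j / (i <= j)%N >-> j <= i}.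
  by move=> a b ab; rewrite lef_pV2 ?posrE ?ltr0n // ler_nat fh.
have sum_head m : (m <= j)%N ->
    \sum_(i < m) s i = \sum_(i < m) (sylvester_y i)%:R^-1.
  by move=> mj; apply: eq_bigr => i _; rewrite s_lt // (leq_trans _ mj).
have sumS : \sum_(i < (j + r).+1) s i = 1.
  rewrite -addnS big_split_ord big_ord_recl /= sum_head // sum_inv_sylvester.
  rewrite addn0 sj (eq_bigr (fun=> K%:R^-1)) => [|i _]; last first.
    by rewrite s_gt // -addSnnS leq_addr.
  by rewrite sumr_const card_ord -mulr_natl /t; ring.
have prodS : \prod_(i < (j + r).+1) s i =
    (K - r * t)%N%:R / (t%:R ^+ 2 * K%:R ^+ r * K%:R).
  rewrite -addnS big_split_ord big_ord_recl /=.
  rewrite (eq_bigr (fun i : 'I_j => (sylvester_y i)%:R^-1)) => [|i _].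
    2: by rewrite s_lt.
  rewrite prod_inv_sylvester addn0 sjE -/t.
  rewrite (eq_bigr (fun=> K%:R^-1)) => [|i _]; last first.
    by rewrite s_gt // -addSnnS leq_addr.
  rewrite prodr_const card_ord exprVn; field.
  by rewrite expf_neq0 ?lt0r_neq0.
have sum_le m : (m < (j + r).+1)%N -> \sum_(i < m) x i <= \sum_(i < m) s i.
  move=> md; case: (leqP m j) => mj.
    by rewrite sum_head // (sum_inv_le_sylvester hf) // (leq_trans mj) ?leq_addr.
  (* Beyond [j] the complementary tails are compared instead, both totals being 1: there [s] is
     constantly [1/K], the least value of [x] up to index [j + r]. *)
  have := sumS; have := fS; rewrite -(subnKC (ltnW md)) !big_split_ord /= => X S.
  suff : \sum_(i < (j + r).+1 - m) s (m + i) <= \sum_(i < (j + r).+1 - m) x (m + i).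
    by move: X S; rewrite /x; lra.
  apply: ler_sum => i _; rewrite s_gt ?(leq_trans mj) ?leq_addr //.
  by apply: xh; have := ltn_ord i; lia.
have [le_sx eq_sx] :=
  prod_le_of_partial_sums s0 x0 xh sum_le (eq_ind_r (fun a => a <= _)
    (eq_ind_r (fun a => 1 <= a) (lexx 1) fS) sumS).
have prodX : \prod_(i < (j + r).+1) x i =
    ((\prod_(i < j + r) f i)%N%:R * K%:R)^-1.
  by rewrite prodfV big_ord_recr natr_prod.
set P := (\prod_(i < j + r) f i)%N in prodX *.
have P0 : 0 < P%:R :> rat by rewrite ltr0n prodn_gt0.
rewrite prodS prodX in le_sx eq_sx.
set A := t%:R ^+ 2 * K%:R ^+ r in le_sx eq_sx.
have A0 : 0 < A by rewrite mulr_gt0 ?exprn_gt0.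
set B := (K - r * t)%N in le_sx eq_sx *.
have AE : (t ^ 2 * K ^ r)%N%:R = A by rewrite natrM !natrX.
have E : (P%:R * K%:R)^-1 = (A / P%:R) / (A * K%:R).
  by field; rewrite !lt0r_neq0.
have AK0 : 0 < (A * K%:R)^-1 by rewrite invr_gt0 mulr_gt0.
split.
  by rewrite -(ler_nat rat) natrM AE mulrC -ler_pdivlMr // -(ler_pM2r AK0) -E.
move=> eqPB.
(* Equality of the integers makes the products of [s] and [x] equal, hence [s] and [x] agree
   termwise. *)
have BE : B%:R = A / P%:R.
  by rewrite -AE -eqPB natrM mulrAC divff ?mul1r ?lt0r_neq0.
have sx i : (i <= j + r)%N -> s i = x i.
  move=> ij; move: eq_sx; rewrite E BE eqxx => /esym/forallP.
  by move/(_ (Ordinal (ij : (i < (j + r).+1)%N)))/eqP.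
have inj (a b : nat) : a%:R^-1 = b%:R^-1 :> rat -> a = b.
  by move/invr_inj/eqP; rewrite eqr_nat => /eqP.
split.
- by move=> i ij; apply: inj; rewrite -s_lt // sx // ltnW // ltn_addr.
- by rewrite -sj sx ?leq_addr.
- by move=> i /andP[ji ij]; apply: inj; rewrite -(s_gt i) // sx.
Qed.

End Majorization.

(** * Numerical bounds for truncated Sylvester partitions *)

(** With [a = b + 1], this combines [(b+1)(b+3) <= (b+2)^2], raised to the power [b], with
    [(b+3)^2 < (t+1)(b+2)^2], which holds because [b] and [t] are positive. *)
Lemma sub_diag_bound_step t a : 0 < t -> 1 < a ->
  t * a.+1 ^ a <= t.+1 ^ a * a ^ a.-1 ->
  t * a.+2 ^ a.+1 < t.+1 ^ a.+1 * a.+1 ^ a.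
Proof.
move=> t0 a1 H; case: a a1 H => // b b0 /= H.
have sq : (b.+1 * b.+3) ^ b <= b.+2 ^ b * b.+2 ^ b.
  by rewrite -expnMn leq_exp2r // mulSn mulnSr; nia.
have p0 : 0 < b.+2 ^ b by rewrite expn_gt0.
have q0 : 0 < t.+1 ^ b by rewrite expn_gt0.
rewrite -(@ltn_pmul2l (b.+2 ^ b.+1)) ?expn_gt0 //.
rewrite expnMn in sq; move: H sq p0 q0; rewrite !expnS.
move: (b.+1 ^ b) (b.+2 ^ b) (b.+3 ^ b) (t.+1 ^ b) => A B C T H sq p0 q0.
have {H} : t * (b.+2 * B) * (b.+3 * (b.+3 * C)) <=
   t.+1 * T * A * (b.+3 * (b.+3 * C)) by rewrite leq_mul2r H orbT.
have {sq} : t.+1 * T * (A * C) * (b.+3 * b.+3) <=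
    t.+1 * T * (B * B) * (b.+3 * b.+3).
  by rewrite leq_mul2r leq_mul2l sq !orbT.
have : t.+1 * T * (B * B) * (b.+3 * b.+3) <
   t.+1 * T * (B * B) * (t.+1 * (b.+2 * b.+2)).
  by rewrite ltn_pmul2l ?muln_gt0 ?p0 ?q0 //; nia.
lia.
Qed.

(** Compares two consecutive constant-tail products after cancelling a power of [sylvester_t j]. At
    [r = 1] it reads [(2t-1)(t-2) >= 0]; from there on the induction step is strict. *)
Lemma sub_diag_bound t r : 0 < t -> 0 < r -> 2 < t + r ->
  t * r.+2 ^ r.+1 <= t.+1 ^ r.+1 * r.+1 ^ r ?= iff (t == 2) && (r == 1).
Proof.
move=> t0; case: r => // r _; elim: r => [|r IHr] tr.
  by rewrite andbT; split; [|apply/eqP/eqP]; nia.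
suff lt_r : t * r.+4 ^ r.+3 < t.+1 ^ r.+3 * r.+3 ^ r.+2.
  by rewrite andbF; split; rewrite ?ltn_eqF // ltnW.
case: (ltnP 2 (t + r.+1)) => [tr1|tr2].
  by apply: sub_diag_bound_step => //; case: (IHr tr1).
(* The bound fails at [t = r = 1], so for [t = 1] the induction starts at [r = 2], with
   [64 < 72]. *)
by have [-> ->] : t = 1 /\ r = 0 by lia.
Qed.

(* The constant tail [r.+1 * t_j, ..., r.+1 * t_j] completing
   [y_0, ..., y_(j-1)] to a unit partition has [r.+1] entries, and the left-hand
   side is then the product of all entries but the last. *)
Lemma constant_tail_le j r : 2 < j + r -> 0 < r ->
  sylvester_t j * (r.+1 * sylvester_t j) ^ r <= 2 * sylvester_t (j + r).-1 ^ 2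
    ?= iff (r == 1) || (j == 1) && (r == 2).
Proof.
elim: r j => // -[|r] IHr j jr _.
  by rewrite addn1 /=; split; [|apply/eqP]; nia.
have := IHr j.+1; rewrite addSnnS => /(_ jr isT) [le1 eq1].
have t0 := sylvester_t_gt0 j.
have tr : 2 < sylvester_t j + r.+1.
  case: r {IHr le1 eq1} jr => [|r] jr; last by lia.
  by have := ltn_sylvester_t j; lia.
have [le2 eq2] := sub_diag_bound t0 (ltn0Sn r) tr.
have t2 : (sylvester_t j == 2) = (j == 1).
  case: j {IHr jr le1 eq1 le2 eq2 t0 tr} => [|[|j]];
    rewrite ?sylvester_tS ?sylvester_t0 //.
  have := ltn_sylvester_t j.+1; rewrite ?sylvester_tS; nia.
rewrite t2 in eq2.
pose c := sylvester_t j ^ r.+2.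
have c0 : 0 < c by rewrite expn_gt0 t0.
have E1 : sylvester_t j * (r.+3 * sylvester_t j) ^ r.+2 =
    c * (sylvester_t j * r.+3 ^ r.+2) by rewrite expnMn /c; lia.
have E2 : sylvester_t j.+1 * (r.+2 * sylvester_t j.+1) ^ r.+1 =
    c * ((sylvester_t j).+1 ^ r.+2 * r.+2 ^ r.+1).
  by rewrite expnMn sylvester_tS !expnMn /c !expnS; lia.
rewrite {}E2 in le1 eq1; rewrite {}E1 /=.
have le12 : c * (sylvester_t j * r.+3 ^ r.+2) <=
  c * ((sylvester_t j).+1 ^ r.+2 * r.+2 ^ r.+1) by rewrite leq_mul2l le2 orbT.
split; first exact: leq_trans le12 le1.
rewrite eqSS -eq2.
(* Equality overall forces equality in [le12], that is [j = 1] and [r = 0]; conversely [eq1] then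
   holds because its tail exponent is 1. *)
apply/eqP/eqP => [E|/eqP E].
  by apply/eqP; rewrite -(eqn_pmul2l c0) eqn_leq le12 /= E.
move/eqP: (E) ->; apply/eqP; rewrite eq1.
by move: E; rewrite eq2 eqSS => /andP[_ ->].
Qed.

(** Convexity of [x^r]: at [a + u] the graph lies below the chord from [a] to [a + u + v], here
    cleared of the denominator [u + v]. *)
Lemma expn_chord r a u v :
  (a + u) ^ r * (u + v) <= a ^ r * v + (a + u + v) ^ r * u.
Proof.
elim: r => [|r IHr]; first by rewrite !expn0; lia.
have : a ^ r <= (a + u + v) ^ r by case: r {IHr} => // r; rewrite leq_exp2r //; lia.
rewrite !expnS; move: (a ^ r) ((a + u) ^ r) ((a + u + v) ^ r) IHr => A X B IH AB.
have : (a + u) * (X * (u + v)) <= (a + u) * (A * v + B * u).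
  by rewrite leq_mul2l IH orbT.
have : u * v * A <= u * v * B by rewrite leq_mul2l AB orbT.
lia.
Qed.

(* Convexity of [K ^ r] reduces this to the end points [r.+1 * t_j] and
   [r * t_(j+1)], where it is [constant_tail_le] at [(j, r)] and at
   [(j.+1, r.-1)]. *)
Lemma truncated_sylvester_between j r K : 2 < j + r -> 1 < r ->
  r.+1 * sylvester_t j <= K < r * sylvester_t j.+1 ->
  sylvester_t j ^ 2 * K ^ r <=
     2 * sylvester_t (j + r).-1 ^ 2 * (K - r * sylvester_t j)
  /\ (sylvester_t j ^ 2 * K ^ r =
        2 * sylvester_t (j + r).-1 ^ 2 * (K - r * sylvester_t j) ->
      j = 1 /\ r = 2).
Proof.
case: r => // r jr r1 /andP[aK Kb].
have jr1 : 2 < j.+1 + r by rewrite addSnnS.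
have [le0 eq0] := constant_tail_le jr (ltn0Sn r).
have [le1 _] := constant_tail_le jr1 r1.
move: le1; rewrite addSnnS => le1.
set M := 2 * _ ^ 2 in le0 eq0 le1 *.
have [u Ku] : exists u, K = r.+2 * sylvester_t j + u.
  by exists (K - r.+2 * sylvester_t j); rewrite subnKC.
have [v Kv] : exists v, r.+1 * sylvester_t j.+1 = K + v.
  by exists (r.+1 * sylvester_t j.+1 - K); rewrite subnKC // ltnW.
have v0 : 0 < v by lia.
have := expn_chord r.+1 (r.+2 * sylvester_t j) u v; rewrite -Ku -Kv.
have -> : K - r.+1 * sylvester_t j = sylvester_t j + u by rewrite Ku; lia.
have t0 := sylvester_t_gt0 j.
move: le0 le1 eq0 Kv.
rewrite sylvester_tS.
set t := sylvester_t j in t0 Ku *.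
set A := (r.+2 * t) ^ r.+1; set X := K ^ r.+1.
rewrite [X in _ -> _ -> _ -> _ -> _ <= _ + X * _ -> _]expnS.
set B := (r.+1 * (t * t.+1)) ^ r.
move=> le0 le1 eq0 Kv chord.
have H1 : t * v * (t * A) <= t * v * M by rewrite leq_mul2l le0 orbT.
(* The factor [K - r.+1 * t] is linear in [K], with values [t] and [r.+1 * t ^ 2] at the end points;
   this is its interpolation at [K]. *)
have uv : t * v + r.+1 * t ^ 2 * u = (t + u) * (u + v).
  have -> : r.+1 * t ^ 2 = t + u + v by move: Kv; rewrite Ku expnS expn1; lia.
  by lia.
have H2 : r.+1 * t ^ 2 * u * (t * t.+1 * B) <= r.+1 * t ^ 2 * u * M.
  by rewrite leq_mul2l le1 orbT.
have H3 : t ^ 2 * (X * (u + v)) <=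
    t ^ 2 * (A * v + r.+1 * (t * t.+1) * B * u).
  by rewrite leq_mul2l chord orbT.
have uv0 : 0 < u + v by lia.
have main : t ^ 2 * X * (u + v) <= M * (t + u) * (u + v).
  rewrite -[M * _ * _]mulnA -uv -mulnA.
  apply: leq_trans H3 _; rewrite [M * _]mulnC mulnDl.
  by apply: leq_trans (leq_add H1 H2); apply: eq_leq; ring.
split; first by rewrite -(leq_pmul2r uv0).
move=> E.
(* As [v > 0], the lower end point has positive weight, so equality at [K] forces equality there. *)
have : t * A == M.
  have tv0 : 0 < t * v by rewrite muln_gt0 t0.
  rewrite -(eqn_pmul2l tv0) eqn_leq H1 /=.
  have := congr1 (muln^~ (u + v)) E => /= {}E.
  rewrite -(leq_add2r (r.+1 * t ^ 2 * u * M)) -mulnDl uv mulnC mulnA -E -mulnA.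
  apply: leq_trans H3 _; rewrite -(leq_add2l (t * v * (t * A))) in H2.
  by apply: leq_trans H2; apply: eq_leq; ring.
by rewrite eq0 eqn_leq leqNgt r1 /= => /andP[/eqP-> /eqP->].
Qed.

(** * The product of all entries but the largest *)

Lemma sorted_unit_partition_last d f : sorted_unit_partition d f -> d < f d.
Proof.
move=> [f0 fh fS].
have K0 : (0 < (f d)%:R :> rat)%R by rewrite ltr0n.
rewrite -(ler_nat rat) -[leRHS]mul1r -ler_pdivrMr // -[leRHS]fS.
have -> : (d.+1%:R / (f d)%:R = \sum_(i < d.+1) (f d)%:R^-1 :> rat)%R.
  by rewrite sumr_const card_ord mulr_natl.
apply: ler_sum => i _; rewrite lef_pV2 ?posrE ?ltr0n // ler_nat fh //.
by rewrite -ltnS ltn_ord.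
Qed.

Lemma prod_but_last_le d f : 2 < d -> sorted_unit_partition d f ->
  \prod_(i < d) f i <= 2 * sylvester_t d.-1 ^ 2 /\
  (\prod_(i < d) f i = 2 * sylvester_t d.-1 ^ 2 ->
   [/\ forall i, i < d.-1 -> f i = sylvester_y i,
       f d.-1 = 2 * sylvester_t d.-1 & f d = 2 * sylvester_t d.-1] \/
   d = 3 /\ [/\ f 0 = 2, f 1 = 6, f 2 = 6 & f 3 = 6]).
Proof.
move=> d3 hf; have [f0 fh fS] := hf.
have inj (a b : nat) : (a%:R^-1 = b%:R^-1 :> rat)%R -> a = b.
  by move/invr_inj/eqP; rewrite eqr_nat => /eqP.
set P := \prod_(i < d) f i; set M := 2 * _.
(* Starting from [j = 0], where the hypothesis is [d < f d], [j] is raised as long as the hypothesis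
   persists. The search ends at [j = d.-1] or in the range of [truncated_sylvester_between]. *)
suff H r j : j + r.+1 = d -> r.+2 * sylvester_t j <= f d ->
    P <= M /\ (P = M -> [/\ forall i, i < d.-1 -> f i = sylvester_y i,
       f d.-1 = 2 * sylvester_t d.-1 & f d = 2 * sylvester_t d.-1] \/
     d = 3 /\ [/\ f 0 = 2, f 1 = 6, f 2 = 6 & f 3 = 6]).
  case: d d3 hf {fS} @P @M H => // d d3 hf P M H.
  by apply: (H d 0) => //; rewrite sylvester_t0 muln1 (sorted_unit_partition_last hf).
elim: r j => [|r IHr] j jr Kj.
  have dj : d.-1 = j by rewrite -jr addn1.
  have t0 := sylvester_t_gt0 j.
  have := @prod_le_truncated_sylvester j 1 f.
  rewrite jr mul1n => /(_ hf) []; first by apply: leq_trans Kj; lia.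
  rewrite -/P expn1 => le1 eq1; rewrite /M dj in le1 eq1 *.
  set t := sylvester_t j in t0 Kj le1 eq1 *.
  have tK : t ^ 2 * f d <= 2 * t ^ 2 * (f d - t).
    by rewrite [2 * _]mulnC -mulnA leq_mul2l; apply/orP; right; lia.
  have Kt0 : 0 < f d - t by lia.
  split; first by rewrite -(leq_pmul2r Kt0) (leq_trans le1 tK).
  move=> PM; left; rewrite PM in le1 eq1.
  have Kt : f d = 2 * t.
    have : t ^ 2 * (2 * (f d - t)) <= t ^ 2 * f d by rewrite mulnCA mulnA.
    by rewrite leq_pmul2l ?expn_gt0 ?t0 //; lia.
  have [|yj fj _] := eq1; first by rewrite Kt; nia.
  split=> //; apply: inj; rewrite fj Kt natrM -/t.
  have : (t%:R != 0 :> rat)%R by rewrite pnatr_eq0 -lt0n.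
  by move=> t0'; field.
case: (leqP (r.+2 * sylvester_t j.+1) (f d)) => [Kb|bK].
  by apply: (IHr j.+1); rewrite // addSnnS.
have jr3 : 2 < j + r.+2 by rewrite jr.
have [||le1 eq1] := @truncated_sylvester_between j r.+2 (f d) jr3; rewrite ?Kj //.
rewrite jr -/M in le1 eq1.
have := @prod_le_truncated_sylvester j r.+2 f.
have t0 := sylvester_t_gt0 j.
have Kt : r.+2 * sylvester_t j < f d.
  by apply: leq_trans Kj; rewrite [r.+3 * _]mulSn -addn1 addnC leq_add2r.
rewrite jr => /(_ hf Kt) [leP eqP']; rewrite -/P in leP eqP'.
have Kt0 : 0 < f d - r.+2 * sylvester_t j by rewrite subn_gt0.
split; first by rewrite -(leq_pmul2r Kt0) (leq_trans leP le1).
move=> PM; right; rewrite PM in leP eqP'.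
have E : M * (f d - r.+2 * sylvester_t j) = sylvester_t j ^ 2 * f d ^ r.+2.
  by apply/eqP; rewrite eqn_leq leP le1.
have [j1 [r0]] := eq1 (esym E); have [yj fj fj2] := eqP' E.
subst j r; have d3' : d = 3 by rewrite -jr.
have t1 : sylvester_t 1 = 2 by rewrite sylvester_tS sylvester_t0.
have t2 : sylvester_t 2 = 6 by rewrite sylvester_tS t1.
rewrite d3' /M t1 t2 d3' /= in E Kj bK fj fj2 *.
(* [E] amounts to [(K - 6)(K - 12) = 0] for [K = f 3], and [bK] gives [K < 12]. *)
have K6 : f 3 = 6 by nia.
split=> //; split=> //.
- by rewrite yj // sylvester_y_t sylvester_t0.
- by apply: inj; rewrite fj K6.
- by rewrite fj2.
Qed.

(** * Divisibility: the square of the lcm *)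

(** Multiplying the unit equation by [k i * L] gives [L + k i * S = k i * L], where [S], the sum of
    the other [L / k j], is an integer. *)
Lemma dvdn_lcm_others (I : finType) (k : I -> nat) (i : I) :
  (forall j, 0 < k j) -> (\sum_j (k j)%:R^-1 = 1 :> rat)%R ->
  k i %| \big[lcmn/1]_(j | j != i) k j.
Proof.
move=> k0; rewrite (bigD1 i) //=; set L := \big[lcmn/1]_(j | j != i) k j => kS.
have Lk j : j != i -> ((k j)%:R^-1 * L%:R = (L %/ k j)%:R :> rat)%R.
  move=> ji; have : k j %| L by rewrite /L (bigD1 j) //= dvdn_lcml.
  have : ((k j)%:R != 0 :> rat)%R by rewrite pnatr_eq0 -lt0n.
  by move=> kj0 /divnK {1}<-; rewrite natrM mulrC mulfK.
have : (L + k i * (\sum_(j | j != i) L %/ k j) = k i * L)%N.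
  apply/eqP; rewrite -(eqr_nat rat) natrD !natrM natr_sum.
  rewrite -(eq_bigr _ Lk) -mulr_suml.
  have : ((k i)%:R != 0 :> rat)%R by rewrite pnatr_eq0 -lt0n.
  move: kS; move: (\sum_(j | _) _)%R ((k i)%:R)%R (L%:R)%R => S K l KS K0.
  have -> : (S = 1 - K^-1)%R by lra.
  by apply/eqP; field.
move=> E; rewrite -(@dvdn_addl (k i * \sum_(j | j != i) L %/ k j)) ?dvdn_mulr //.
by rewrite E dvdn_mulr.
Qed.

Lemma biglcm_gt0 (I : finType) (A : pred I) (k : I -> nat) :
  (forall j, 0 < k j) -> 0 < \big[lcmn/1]_(j | A j) k j.
Proof. by move=> k0; elim/big_ind: _ => // a b a0 b0; rewrite lcmn_gt0 a0. Qed.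

Lemma logn_biglcm (I : finType) (A : pred I) (k : I -> nat) p :
  (forall j, 0 < k j) ->
  logn p (\big[lcmn/1]_(j | A j) k j) = \max_(j | A j) logn p (k j).
Proof.
move=> k0.
suff [] : 0 < \big[lcmn/1]_(j | A j) k j /\
  logn p (\big[lcmn/1]_(j | A j) k j) = \max_(j | A j) logn p (k j) by [].
elim/big_ind2: _ => [|a b c e [a0 <-] [c0 <-]|j _]; rewrite ?logn1 //.
by rewrite lcmn_gt0 a0 c0 logn_lcm.
Qed.

(* An entry of maximal [p]-adic valuation divides the lcm of the others, so the
   maximum is attained twice. *)
Lemma lcm_sqr_dvdn_prod (I : finType) (k : I -> nat) :
  (forall j, 0 < k j) -> (\sum_j (k j)%:R^-1 = 1 :> rat)%R ->
  (\big[lcmn/1]_j k j) ^ 2 %| \prod_j k j.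
Proof.
move=> k0 kS.
apply/dvdn_partP; first by rewrite expn_gt0 biglcm_gt0.
move=> p; rewrite mem_primes => /andP[p_pr _].
rewrite p_part lognX logn_biglcm //; set e := \max_(j | _) _.
have [->|e0] := posnP e; first by rewrite muln0 dvd1n.
have [i0 ei0] : exists i0, e = logn p (k i0).
  case: (pickP (@predT I)) => [i _|I0]; last by move: e0; rewrite /e big_pred0.
  have I_gt0 : 0 < #|I| by apply/card_gt0P; exists i.
  by exists [arg max_(i > i) logn p (k i)]; apply: bigmax_eq_arg.
have [j0 ji ej0] : exists2 j0, j0 != i0 & e <= logn p (k j0).
  have : e <= \max_(j | j != i0) logn p (k j).
    by rewrite -logn_biglcm // ei0 dvdn_leq_log ?dvdn_lcm_others ?biglcm_gt0.
  case: (pickP (fun j => (j != i0) && (e <= logn p (k j)))) => [j /andP[]|H].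
    by exists j.
  rewrite leqNgt -(prednK e0) ltnS => /negP[].
  apply/bigmax_leqP => j ji.
  by rewrite -ltnS prednK // ltnNge; move: (H j); rewrite ji /= => ->.
rewrite (bigD1 i0) //= (bigD1 j0) //= mulSn mul1n expnD dvdn_mul //.
  by rewrite pfactor_dvdn // -ei0.
by rewrite dvdn_mulr // pfactor_dvdn.
Qed.

(** * The lower bound on the product *)

(** AM-GM for the reciprocals, whose mean is [1/(n+1)]; equality makes them all equal to that
    mean. *)
Lemma prod_ge_constant n (k : 'I_n.+1 -> nat) :
  (forall j, 0 < k j) -> (\sum_j (k j)%:R^-1 = 1 :> rat)%R ->
  n.+1 ^ n.+1 <= \prod_j k j ?= iff [forall i, k i == n.+1].
Proof.
move=> k0 kS.
pose E (i : 'I_n.+1) : rat := ((k i)%:R^-1)%R.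
have E0 : {in 'I_n.+1, forall i, 0 <= E i}%R by move=> i _; rewrite invr_ge0.
have [] := leif_AGM E0.
rewrite card_ord kS mul1r /E prodfV -natr_prod exprVn -natrX.
have P0 : 0 < \prod_i k i by rewrite prodn_gt0.
rewrite lef_pV2 ?posrE ?ltr0n ?expn_gt0 // ler_nat => le_nP eq_nP.
split=> //; apply/eqP/forallP => [eqPn|kn]; last first.
  rewrite (eq_bigr (fun=> n.+1)) => [|i _]; last exact/eqP/kn.
  by rewrite prod_nat_const card_ord.
move=> i; move: eq_nP; rewrite eqPn eqxx => /esym/forall_inP Ec.
move: kS; rewrite (eq_bigr (fun=> (k i)%:R^-1)%R) => [|j _]; last first.
  by apply/esym/eqP; have /forall_inP/(_ j isT) := Ec i isT.
rewrite sumr_const card_ord -[X in X = _]mulr_natl => /divr1_eq nk.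
by rewrite -(eqr_nat rat) nk.
Qed.

(** * Passage from tuples to sorted partitions, and the three bounds *)

Lemma sorted_unit_partition_seq d (s : seq nat) : size s = d.+1 ->
  sorted leq s -> all (leq 1) s -> (\sum_(y <- s) y%:R^-1 = 1 :> rat)%R ->
  exists2 f, sorted_unit_partition d f & s = mkseq f d.+1.
Proof.
(* The default of [nth] is the last entry, which keeps [f] positive and monotone beyond [d]. *)
move=> ss s_sorted s0 sS; pose f := nth (nth 0 s d) s.
have last0 : 0 < nth 0 s d by apply: (all_nthP 0 s0); rewrite ss.
exists f; last by rewrite -ss mkseq_nth.
split.
- move=> i; case: (ltnP i (size s)) => si.
    exact: (all_nthP _ s0).
  by rewrite /f nth_default.
- have H a b : a <= b -> b < d.+1 -> f a <= f b.
    move=> ab bd; apply: (sorted_leq_nth leq_trans leqnn) => //.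
    - by rewrite inE ss (leq_ltn_trans ab).
    - by rewrite inE ss.
  have fd i : d <= i -> f i = f d.
    rewrite leq_eqVlt => /predU1P[<- //|di].
    by rewrite /f nth_default ?ss // (set_nth_default 0) ?ss.
  move=> a b ab; case: (ltnP b d.+1) => [|bd]; first exact: H.
  rewrite (fd b (ltnW bd)); case: (leqP a d) => [ad|da]; first exact: H.
  by rewrite (fd a (ltnW da)).
- by rewrite -[RHS]sS (big_nth (nth 0 s d)) big_mkord ss.
Qed.

Theorem theorem5p1 (d : nat) (k : d.+1.-tuple nat) (hd : 2 <= d)
    (hk : unit_partition k) :
  [/\ [/\ (lcm_entries k) ^ 2 <= prod_entries k,
          prod_entries k <= (sylvester_t d) ^ 2
        & prod_entries k = (sylvester_t d) ^ 2 <->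
          perm_eq k (sylvester_partition d)],
      d.+1 ^ d.+1 <= prod_entries k /\
      (prod_entries k = d.+1 ^ d.+1 <-> forall i : 'I_d.+1, tnth k i = d.+1)
    & 3 <= d ->
      (forall i j : 'I_d.+1, i <= j -> tnth k i <= tnth k j) ->
      [/\ ((prod_entries k)%:R / (lcm_entries k)%:R <=
             (prod_but_last k)%:R :> rat)%R,
          prod_but_last k <= 2 * (sylvester_t d.-1) ^ 2
        & prod_but_last k = 2 * (sylvester_t d.-1) ^ 2 <->
          (k = enlarged_sylvester_partition d :> seq nat) \/
          (k = [:: 2; 6; 6; 6] :> seq nat)]].
Proof.
have [k0 kS] := hk.
have all0 : all (leq 1) k by apply/all_tnthP.
have kS' : (\sum_(y <- k) y%:R^-1 = 1 :> rat)%R by rewrite big_tuple.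
have prodE : prod_entries k = \prod_(y <- k) y by rewrite big_tuple.
have prod_mkseq (F : nat -> nat) n : \prod_(y <- mkseq F n) y = \prod_(i < n) F i.
  by rewrite big_map -(big_mkord xpredT F) /index_iota subn0.
have P0 : 0 < prod_entries k by rewrite prodn_gt0.
have [le_nP eq_nP] := prod_ge_constant k0 kS.
split; last 1 first.
- move=> d3 k_sorted.
  have [f hf kf] : exists2 f, sorted_unit_partition d f & val k = mkseq f d.+1.
    apply: sorted_unit_partition_seq; rewrite ?size_tuple //.
    apply/(sortedP 0) => i; rewrite size_tuple => id.
    have := k_sorted (Ordinal (ltnW id)) (Ordinal id) (leqnSn i).
    by rewrite !(tnth_nth 0).
  have PE : prod_but_last k = \prod_(i < d) f i.
    apply: eq_bigr => i _; rewrite (tnth_nth 0) kf nth_mkseq //=.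
    by rewrite ltnS ltnW.
  have [le_PM eq_PM] := prod_but_last_le d3 hf.
  split; rewrite ?PE //.
    (* The last entry divides the lcm, so dividing the product by the lcm leaves at most the product
       of the other entries. *)
    rewrite ler_pdivrMr ?ltr0n ?biglcm_gt0 // -natrM ler_nat.
    rewrite /prod_entries big_ord_recr /= -PE leq_mul2l dvdn_leq ?orbT ?biglcm_gt0 //.
    by rewrite /lcm_entries (bigD1 ord_max) //= dvdn_lcml.
  case: d d3 {le_nP eq_nP P0 prodE kS' all0 kS k0 k_sorted PE hd hk} k hf kf
    le_PM eq_PM => // e _ k hf kf _ eq_PM.
  rewrite kf /enlarged_sylvester_partition /= in eq_PM *.
  have mkseq2 : mkseq f e.+2 = mkseq f e ++ [:: f e; f e.+1].
    by rewrite !mkseqS -!cats1 -catA.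
  split=> [/eq_PM [[fy fe fe1]|[[e2] [f0 f1 f2 f3]]]|].
  + left; rewrite mkseq2 fe fe1; congr (_ ++ _).
    apply: (@eq_from_nth _ 0); rewrite !size_mkseq // => i ie.
    by rewrite !nth_mkseq ?fy.
  + by right; rewrite e2 /mkseq /= f0 f1 f2 f3.
  case=> [|kE].
    rewrite mkseq2 => /eqP; rewrite eqseq_cat ?size_mkseq //.
    case/andP=> /eqP fy /eqP[fe _].
    rewrite big_ord_recr /= -prod_mkseq fy prod_mkseq -sylvester_tE fe; ring.
  have := congr1 size kE; rewrite size_mkseq /= => -[e2]; subst e.
  move: kE; rewrite /mkseq /= => -[f0 f1 f2 f3].
  by rewrite !big_ord_recr big_ord0 /= f0 f1 f2 !sylvester_tS sylvester_t0.
- split.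
  + by rewrite dvdn_leq // lcm_sqr_dvdn_prod.
  all: have [||||f hf sf] := @sorted_unit_partition_seq d (sort leq k);
    [by rewrite size_sort size_tuple | exact: (sort_sorted leq_total)
    | by rewrite all_sort | by rewrite (perm_big k) // perm_sort |].
  all: have kf : perm_eq k (mkseq f d.+1) by rewrite -sf perm_sym perm_sort.
  all: have fd0 : 0 < f d by case: hf.
  (* With [j = d] and [r = 0] the constant tail is empty and the majorant is the Sylvester partition
     itself. *)
  all: have := @prod_le_truncated_sylvester d 0 f;
    rewrite addn0 => /(_ hf fd0) [].
  all: rewrite mul0n subn0 muln1 => le_P eq_P.
  all: have PE : prod_entries k = \prod_(i < d) f i * f d
    by rewrite prodE (perm_big _ kf) prod_mkseq big_ord_recr.
  + by rewrite PE.
  rewrite PE; split=> [/eq_P[fy fd _]|kS2].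
    apply: perm_trans kf _; rewrite /sylvester_partition mkseqS.
    have -> : f d = sylvester_t d.
      move: fd; rewrite mul0r subr0 => /invr_inj/eqP.
      by rewrite eqr_nat => /eqP.
    suff -> : mkseq f d = mkseq sylvester_y d by [].
    apply: (@eq_from_nth _ 0); rewrite !size_mkseq // => i id.
    by rewrite !nth_mkseq ?fy.
  rewrite -PE prodE (perm_big _ kS2) /sylvester_partition -cats1 big_cat /=.
  by rewrite big_seq1 prod_mkseq -sylvester_tE mulnn.
- split=> //; rewrite /prod_entries; split=> [/esym/eqP|kd].
    by rewrite eq_nP => /forallP kd i; apply/eqP.
  by apply/esym/eqP; rewrite eq_nP; apply/forallP => i; apply/eqP.
Qed.
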